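(* For any integers $m,n\ge3$ and any $p\in(0,1)$, \[ \tilde r(m,n;p)\le\min\{f(K_m,p),f(K_n,1-p)\}\le 3\,\tilde r(m,n;p). \]
   Context: The $(m,n)$-online Ramsey game is played on an infinite set of initially isolated vertices: each turn, Builder places an edge between two nonadjacent vertices and Painter immediately paints it red or blue; Builder wins once there is a red $K_m$ or a blue $K_n$. For $p\in(0,1)$, $\tilde r(m,n;p)$ is the number of turns Builder needs to win this game with probability at least $\frac12$ (i.e. the minimum $N$ such that some Builder strategy wins within $N$ turns with probability at least $\frac12$) against a Painter who independently paints each edge red with probability $p$ and blue with probability $1-p$. In the Subgraph Query Game with parameter $p\in(0,1)$, Builder plays alone on the random graph $G(\mathbb Z,p)$ with infinitely many vertices, whose edges are initially hidden. At each turn Builder queries (adaptively) one pair of vertices and is told whether it is an edge; equivalently, each queried edge is built successfully, independently, with probability $p$, and each pair may be queried at most once. For a graph $H$, $f(H,p)$ is the minimum, over all Builder strategies, of the number of turns needed to build a copy of $H$ with probability at least $\frac12$. *)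

(* Defs.v *)
From mathcomp Require Import all_boot all_order all_algebra.
From mathcomp Require Import boolp reals.

Set Implicit Arguments.
Unset Strict Implicit.
Unset Printing Implicit Defensive.

Import Order.TTheory GRing.Theory Num.Theory.
Local Open Scope ring_scope.

(* Both games are played on the vertex set [int].  In both of them Builder     *)
(* names a pair at each turn and is told one random bit: the colour of the     *)
(* edge ([true] = red), resp. whether the query succeeded ([true] = built).    *)

(* Builder's next pair, as a function of the bits received so far, oldest      *)
(* first.  Builder's own earlier moves are determined by these bits.           *)
Definition strategy := seq bool -> int * int.

Definition same_pair (e e' : int * int) : bool :=
  (e == e') || (e == (e'.2, e'.1)).

(* No loops, and no pair is played twice.  As the vertex set is infinite, a    *)
(* legal move always exists, so strategies can be total.                       *)
Definition legal (s : strategy) : Prop :=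
  forall h : seq bool,
    (s h).1 != (s h).2 /\
    forall i : nat, (i < size h)%N -> ~~ same_pair (s (take i h)) (s h).

(* The graph of the pairs that received answer [b] when Builder follows [s]    *)
(* and the successive answers are [h].                                         *)
Definition answer_graph (s : strategy) (h : seq bool) (b : bool) : rel int :=
  fun x y => [exists i : 'I_(size h),
    (nth false h i == b) && same_pair (s (take i h)) (x, y)].

(* Copies are not required to be induced. *)
Definition has_copy (T : finType) (H : rel T) (G : rel int) : Prop :=
  exists2 f : T -> int, injective f & forall x y, H x y -> G (f x) (f y).

Definition complete_graph (k : nat) : rel 'I_k := fun x y => x != y.
Arguments complete_graph k x y : clear implicits.

(* The probability that [N] independent bits, each [true] with probability     *)
(* [p], satisfy [W].                                                           *)
Definition bits_prob (R : realType) (p : R) (N : nat) (W : seq bool -> Prop) : R :=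
  \sum_(c : N.-tuple bool | `[< W c >]) \prod_(b <- c) (if b then p else 1 - p).

(* Edges are never removed, so a goal graph occurs within the first [N] turns  *)
(* iff it is present after turn [N].                                           *)
Definition ramsey_won (m n : nat) (s : strategy) (h : seq bool) : Prop :=
  has_copy (complete_graph m) (answer_graph s h true) \/
  has_copy (complete_graph n) (answer_graph s h false).

Definition ramsey_winnable (R : realType) (m n : nat) (p : R) (N : nat) : Prop :=
  exists2 s : strategy, legal s & 1 / 2 <= bits_prob p N (ramsey_won m n s).

Definition query_won (T : finType) (H : rel T) (s : strategy) (h : seq bool) : Prop :=
  has_copy H (answer_graph s h true).

Definition query_winnable (R : realType) (T : finType) (H : rel T) (p : R)
    (N : nat) : Prop :=
  exists2 s : strategy, legal s & 1 / 2 <= bits_prob p N (query_won H s).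

Definition is_minimum (P : nat -> Prop) (N : nat) : Prop :=
  P N /\ forall k : nat, P k -> (N <= k)%N.

Definition is_online_ramsey (R : realType) (m n : nat) (p : R) : nat -> Prop :=
  is_minimum (ramsey_winnable m n p).

Definition is_subgraph_query (R : realType) (T : finType) (H : rel T) (p : R) :
    nat -> Prop :=
  is_minimum (query_winnable H p).

(* Main.v *)
Require Import Defs.
From mathcomp Require Import all_boot all_order all_algebra.
From mathcomp Require Import boolp reals.
From mathcomp Require Import zify ring lra.

Set Implicit Arguments.
Unset Strict Implicit.
Unset Printing Implicit Defensive.

Import Order.TTheory GRing.Theory Num.Theory.
Local Open Scope ring_scope.

(* A winning Ramsey strategy builds a red K_m or a blue K_n with probability   *)
(* at least 1/4; say a red K_m.  Reading red as "built", it is a query         *)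
(* strategy, and playing it three times on disjoint vertex sets succeeds with  *)
(* probability at least 1 - (3/4)^3 = 37/64 > 1/2.  The same repetition        *)
(* argument, started from any strategy that succeeds with positive             *)
(* probability, shows that the three minima exist.                             *)

(** Both games deliver the same random bits and differ only in the goal: red at rate [p] reads as
    built for [K_m], and blue at rate [1 - p] as built for [K_n]. Hence a query strategy for either
    clique wins the Ramsey game in the same number of turns, with answers negated in the blue case
    ([query_ramsey_winnable], [query_ramsey_winnable_compl]); this gives the left inequality.
    Conversely, the union bound makes one colour succeed with probability at least 1/4, and failure
    probabilities of runs on disjoint vertex sets multiply ([bits_prob_cat], [query_repeat]), so
    three runs suffice ([ramsey_query_winnable]). *)

Section BitsProb.
Variable R : realType.
Implicit Types (p : R) (N M : nat) (W A B : seq bool -> Prop).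

(** * Probability of events on independent bits *)

Lemma bits_prob0 p W : bits_prob p 0 W = (`[< W [::] >])%:R.
Proof.
rewrite /bits_prob big_mkcond (big_pred1 [tuple]) => [|c]; last first.
  by rewrite [c]tuple0 /= eqxx.
by rewrite big_nil; case: ifP.
Qed.

(** Conditioning on the first bit. The estimates below are inductions on [N] through this
    recursion. *)
Lemma bits_probS p N W :
  bits_prob p N.+1 W = p * bits_prob p N (fun h => W (true :: h))
                     + (1 - p) * bits_prob p N (fun h => W (false :: h)).
Proof.
pose cons_tup (x : bool * N.-tuple bool) := cons_tuple x.1 x.2.
pose uncons_tup (c : N.+1.-tuple bool) := (thead c, behead_tuple c).
rewrite /bits_prob (reindex cons_tup) /=; last first.
  exists uncons_tup => [[b c] _|c _]; last by rewrite [RHS]tuple_eta.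
  by congr pair; apply: val_inj.
rewrite -(pair_big_dep xpredT (fun b (c : N.-tuple bool) => `[< W (b :: c) >])
  (fun b (c : N.-tuple bool) =>
     \prod_(b' <- b :: c) (if b' then p else 1 - p))) /=.
rewrite big_bool /=.
by congr (_ + _); rewrite mulr_sumr; apply: eq_bigr => c _; rewrite big_cons.
Qed.

Lemma bits_prob_true p N W : (forall h, size h = N -> W h) -> bits_prob p N W = 1.
Proof.
elim: N W => [|N IH] W hW; first by rewrite bits_prob0 asboolT //; apply: hW.
rewrite bits_probS !IH; first by ring.
all: by move=> h sz; apply: hW; rewrite /= sz.
Qed.

Lemma bits_prob_negb p N W :
  bits_prob (1 - p) N W = bits_prob p N (fun h => W (map negb h)).
Proof.
elim: N W => [|N IH] W; first by rewrite !bits_prob0.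
by rewrite !bits_probS !IH /=; ring.
Qed.

Lemma bits_prob_ge0 p N W : 0 < p < 1 -> 0 <= bits_prob p N W.
Proof.
move=> /andP[p0 p1]; elim: N W => [|N IH] W; first by rewrite bits_prob0 ler0n.
by rewrite bits_probS addr_ge0 ?mulr_ge0 ?IH //; lra.
Qed.

Lemma bits_prob_gt0 p N W : 0 < p < 1 -> W (nseq N true) -> 0 < bits_prob p N W.
Proof.
move=> hp; elim: N W => [|N IH] W hW; first by rewrite bits_prob0 asboolT.
have /andP[p0 p1] := hp.
rewrite bits_probS ltr_pwDl //; first by rewrite mulr_gt0 // IH.
by rewrite mulr_ge0 ?bits_prob_ge0 //; lra.
Qed.

Lemma bits_prob_sub p N A B : 0 < p < 1 ->
  (forall h, size h = N -> A h -> B h) -> bits_prob p N A <= bits_prob p N B.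
Proof.
move=> hp; have /andP[p0 p1] := hp; elim: N A B => [|N IH] A B sAB.
  rewrite !bits_prob0 ler_nat; case: asboolP => // /sAB hB.
  by rewrite asboolT //; apply: hB.
rewrite !bits_probS lerD // ler_wpM2l ?IH //; try lra.
all: by move=> h sz; apply: sAB; rewrite /= sz.
Qed.

Lemma bits_prob_or p N A B : 0 < p < 1 ->
  bits_prob p N (fun h => A h \/ B h) <= bits_prob p N A + bits_prob p N B.
Proof.
move=> hp; have /andP[p0 p1] := hp; elim: N A B => [|N IH] A B.
  rewrite !bits_prob0 -natrD ler_nat.
  by case: (asboolP (A _)) => a; case: (asboolP (B _)) => b;
    case: asboolP => // -[].
rewrite !bits_probS.
have ht := ler_wpM2l (ltW p0) (IH (fun h => A (true :: h)) (fun h => B (true :: h))).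
have q0 : 0 <= 1 - p by lra.
have hf := ler_wpM2l q0 (IH (fun h => A (false :: h)) (fun h => B (false :: h))).
lra.
Qed.

(** If [W] fails, then [A] fails on the first [N] bits and [B] on the next [M], and these failures
    are independent. *)
Lemma bits_prob_cat p N M A B W : 0 < p < 1 ->
    (forall h1 h2, size h1 = N -> A h1 \/ B h2 -> W (h1 ++ h2)) ->
  1 - bits_prob p (N + M) W <= (1 - bits_prob p N A) * (1 - bits_prob p M B).
Proof.
move=> hp; have /andP[p0 p1] := hp; elim: N A W => [|N IH] A W sW.
  rewrite add0n bits_prob0; case: asboolP => [a|_].
    by rewrite subrr mul0r bits_prob_true ?subrr // => h _; apply: (sW [::]) => //; left.
  rewrite subr0 mul1r lerD2l lerN2; apply: bits_prob_sub => // h _ b.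
  by apply: (sW [::]) => //; right.
rewrite addSn !bits_probS.
have step b : 1 - bits_prob p (N + M) (fun h => W (b :: h)) <=
    (1 - bits_prob p N (fun h => A (b :: h))) * (1 - bits_prob p M B).
  by apply: IH => h1 h2 sz; apply: (sW (b :: h1)); rewrite /= sz.
have q0 : 0 <= 1 - p by lra.
(* The weights [p] and [1 - p] sum to 1, so averaging the two inductive bounds commutes with taking
   complements. *)
have := lerD (ler_wpM2l (ltW p0) (step true)) (ler_wpM2l q0 (step false)).
by congr (_ <= _); ring.
Qed.

End BitsProb.

Lemma answer_graphP s h b x y :
  reflect (exists i, [/\ (i < size h)%N, nth false h i = b
                       & same_pair (s (take i h)) (x, y)])
          (answer_graph s h b x y).
Proof.
apply: (iffP existsP) => [[i /andP[/eqP hi hs]]|[i [lt_i hi hs]]].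
  by exists i; split.
by exists (Ordinal lt_i); rewrite /= hi eqxx.
Qed.

Lemma has_copy_map (T : finType) (H : rel T) (G G' : rel int) (g : int -> int) :
  injective g -> (forall x y, G x y -> G' (g x) (g y)) ->
  has_copy H G -> has_copy H G'.
Proof.
move=> inj_g sG [f inj_f sH]; exists (g \o f); first exact: inj_comp.
by move=> x y /sH /sG.
Qed.

(** * Exchanging the two colours *)

Definition flip_strategy (s : strategy) : strategy := fun h => s (map negb h).

Lemma flip_strategy_legal s : legal s -> legal (flip_strategy s).
Proof.
move=> ls h; have [ne fresh] := ls (map negb h); split=> // i lt_i.
by rewrite /flip_strategy map_take; apply: fresh; rewrite size_map.
Qed.

Lemma answer_graph_flip s h b x y :
  answer_graph s (map negb h) b x y ->
  answer_graph (flip_strategy s) h (~~ b) x y.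
Proof.
move=> /answer_graphP[i [lt_i hi hs]]; rewrite size_map in lt_i.
apply/answer_graphP; exists i; split; rewrite /flip_strategy ?map_take //.
by rewrite -hi (nth_map false) // negbK.
Qed.

Lemma has_copy_flip (T : finType) (H : rel T) s h b :
  has_copy H (answer_graph s (map negb h) b) ->
  has_copy H (answer_graph (flip_strategy s) h (~~ b)).
Proof. by apply: (@has_copy_map _ _ _ _ id) => // x y; apply: answer_graph_flip. Qed.

(** * Successive runs on disjoint vertex sets *)

Definition map_pair (g : int -> int) (e : int * int) := (g e.1, g e.2).

Lemma same_pair_map (g : int -> int) (e e' : int * int) : injective g ->
  same_pair (map_pair g e) (map_pair g e') = same_pair e e'.
Proof.
by move=> inj_g; rewrite /same_pair /map_pair !xpair_eqE !(inj_eq inj_g) /= -!xpair_eqE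
  -!surjective_pairing.
Qed.

(** Even and odd integers are two disjoint copies of the whole vertex set, so doubling up can be
    iterated. *)
Definition even_copy (x : int) : int := 2 * x.
Definition odd_copy (x : int) : int := 2 * x + 1.

Lemma even_copy_inj : injective even_copy.
Proof. by rewrite /even_copy => x y; lia. Qed.

Lemma odd_copy_inj : injective odd_copy.
Proof. by rewrite /odd_copy => x y; lia. Qed.

Lemma same_pair_even_odd (e e' : int * int) :
  same_pair (map_pair even_copy e) (map_pair odd_copy e') = false.
Proof.
by rewrite /same_pair /map_pair /even_copy /odd_copy !xpair_eqE /=; lia.
Qed.

Definition seq_strategy (N : nat) (s t : strategy) : strategy := fun h =>
  if (size h < N)%N then map_pair even_copy (s h)
  else map_pair odd_copy (t (drop N h)).

(** Moves of the same run differ by legality of that run, moves of different runs by parity. *)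
Lemma seq_strategy_legal N s t : legal s -> legal t -> legal (seq_strategy N s t).
Proof.
move=> ls lt h; rewrite /seq_strategy; have [ltN|geN] := ltnP (size h) N.
  have [ne fresh] := ls h; split=> [|i lt_i].
    by rewrite (inj_eq even_copy_inj).
  by rewrite size_take lt_i (ltn_trans lt_i ltN) same_pair_map ?fresh //; apply: even_copy_inj.
have [ne fresh] := lt (drop N h); split=> [|i lt_i].
  by rewrite (inj_eq odd_copy_inj).
rewrite size_take lt_i; have [_|geNi] := ltnP i N; first by rewrite same_pair_even_odd.
rewrite same_pair_map; last exact: odd_copy_inj.
have -> : drop N (take i h) = take (i - N) (drop N h).
  by rewrite take_drop subnK.
by apply: fresh; rewrite size_drop ltn_sub2r // (leq_ltn_trans geNi).
Qed.

Lemma answer_graph_seql s t h1 h2 b x y :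
  answer_graph s h1 b x y ->
  answer_graph (seq_strategy (size h1) s t) (h1 ++ h2) b (even_copy x) (even_copy y).
Proof.
move=> /answer_graphP[i [lt_i hi hs]]; apply/answer_graphP; exists i.
rewrite size_cat ltn_addr // nth_cat lt_i takel_cat 1?ltnW //; split=> //.
rewrite /seq_strategy size_take lt_i lt_i.
by rewrite (same_pair_map _ (x, y) even_copy_inj).
Qed.

Lemma answer_graph_seqr s t h1 h2 b x y :
  answer_graph t h2 b x y ->
  answer_graph (seq_strategy (size h1) s t) (h1 ++ h2) b (odd_copy x) (odd_copy y).
Proof.
move=> /answer_graphP[i [lt_i hi hs]]; apply/answer_graphP; exists (size h1 + i)%N.
have take_i : take (size h1 + i) (h1 ++ h2) = h1 ++ take i h2.
  by rewrite take_cat ltnNge leq_addr /= addKn.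
rewrite size_cat ltn_add2l nth_cat [(_ + _ < _)%N]ltnNge leq_addr /= addKn take_i; split=> //.
rewrite /seq_strategy size_cat ltnNge leq_addr /= drop_size_cat //.
by rewrite (same_pair_map _ (x, y) odd_copy_inj).
Qed.

Lemma query_won_seq (T : finType) (H : rel T) s t h1 h2 :
  query_won H s h1 \/ query_won H t h2 ->
  query_won H (seq_strategy (size h1) s t) (h1 ++ h2).
Proof.
case.
  by apply: (has_copy_map even_copy_inj) => x y; apply: answer_graph_seql.
by apply: (has_copy_map odd_copy_inj) => x y; apply: answer_graph_seqr.
Qed.

Lemma query_repeat (R : realType) (T : finType) (H : rel T) (p : R) s N k :
  0 < p < 1 -> legal s ->
  exists2 u, legal u & 1 - bits_prob p (k * N) (query_won H u)
                       <= (1 - bits_prob p N (query_won H s)) ^+ k.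
Proof.
move=> hp ls; elim: k => [|k [u lu IH]].
  (* With no repetition the bound is 1, so any legal strategy serves. *)
  exists s => //; rewrite expr0 gerBl; exact: bits_prob_ge0.
exists (seq_strategy N s u); first exact: seq_strategy_legal.
rewrite mulSn exprS.
apply: le_trans (@bits_prob_cat R p N (k * N) _ (query_won H u) _ hp _) _.
  by move=> h1 h2 <-; apply: query_won_seq.
rewrite ler_wpM2l // subr_ge0 -(@bits_prob_true R p N (fun=> True)) //.
exact: bits_prob_sub.
Qed.

(** * Existence of the minima *)

Definition clique_pairs (k : nat) : seq (int * int) :=
  [seq (Posz e.1, Posz e.2) | e <- allpairs pair (iota 0 k) (iota 0 k) & (e.1 < e.2)%N].

Lemma clique_pairs_uniq k : uniq (clique_pairs k).
Proof.
rewrite map_inj_uniq => [|[x y] [x' y'] /= [-> ->] //].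
rewrite filter_uniq // allpairs_uniq ?iota_uniq //.
by move=> [x y] [x' y'].
Qed.

Lemma mem_clique_pairs k (i j : nat) :
  (i < j)%N -> (j < k)%N -> (Posz i, Posz j) \in clique_pairs k.
Proof.
move=> lt_ij lt_jk; apply/mapP; exists (i, j) => //.
rewrite mem_filter lt_ij allpairs_f // mem_iota //=.
exact: ltn_trans lt_jk.
Qed.

Lemma clique_pairs_lt k e : e \in clique_pairs k -> 0 <= e.1 < e.2.
Proof. by move=> /mapP[[i j]]; rewrite mem_filter => /andP[/= lt_ij _] ->. Qed.

(* The pairs [(-1, i)] are legal filler moves once the clique is exhausted.    *)
Definition clique_pair (k i : nat) : int * int := nth (-1, Posz i) (clique_pairs k) i.

Lemma clique_pair_lt k i : (clique_pair k i).1 < (clique_pair k i).2.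
Proof.
rewrite /clique_pair; have [lt_i|ge_i] := ltnP i (size (clique_pairs k)).
  by have /andP[] := clique_pairs_lt (mem_nth (-1, Posz i) lt_i).
by rewrite nth_default.
Qed.

(** Clique pairs are listed once each, fillers differ in their second coordinate, and the sign of
    the first coordinate separates the two kinds. *)
Lemma clique_pair_inj k : injective (clique_pair k).
Proof.
have nonneg i d : (i < size (clique_pairs k))%N -> 0 <= (nth d (clique_pairs k) i).1.
  by move=> /(mem_nth d) /clique_pairs_lt /andP[].
move=> i j; rewrite /clique_pair.
have [lt_i|ge_i] := ltnP i (size (clique_pairs k));
  have [lt_j|ge_j] := ltnP j (size (clique_pairs k)).
- rewrite (set_nth_default (-1, Posz i) _ lt_j) => /eqP.
  by rewrite nth_uniq ?clique_pairs_uniq // => /eqP.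
- by rewrite [RHS]nth_default // => eq_ij; have := nonneg i (-1, Posz i) lt_i; rewrite eq_ij.
- by rewrite [LHS]nth_default // => eq_ij; have := nonneg j (-1, Posz j) lt_j; rewrite -eq_ij.
- by rewrite !nth_default // => -[].
Qed.

(** A non-adaptive strategy: it wins when every answer is [true], so its success probability is
    positive, which is all that repetition needs. *)
Definition clique_strategy (k : nat) : strategy := fun h => clique_pair k (size h).

Lemma clique_strategy_legal k : legal (clique_strategy k).
Proof.
move=> h; have lt_h := clique_pair_lt k (size h); split=> [|i lt_i].
  by rewrite lt_eqF.
rewrite /clique_strategy size_take lt_i.
apply/norP; split; first by rewrite (inj_eq (@clique_pair_inj k)) ltn_eqF.
(* Every move has its smaller endpoint first, so no move is the reverse of another. *)
apply/eqP => eq_i; have := clique_pair_lt k i.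
by rewrite eq_i /= ltNge (ltW lt_h).
Qed.

Lemma clique_strategy_won k :
  query_won (complete_graph k) (clique_strategy k) (nseq (size (clique_pairs k)) true).
Proof.
have won (i j : nat) : (i < j)%N -> (j < k)%N -> exists l,
    [/\ (l < size (clique_pairs k))%N, nth false (nseq (size (clique_pairs k)) true) l
      & clique_strategy k (take l (nseq (size (clique_pairs k)) true)) = (Posz i, Posz j)].
  move=> lt_ij /(mem_clique_pairs lt_ij) mem_ij.
  have lt_l : (index (Posz i, Posz j) (clique_pairs k) < size (clique_pairs k))%N.
    by rewrite index_mem.
  exists (index (Posz i, Posz j) (clique_pairs k)); split=> //.
    by rewrite nth_nseq lt_l.
  by rewrite /clique_strategy size_take size_nseq lt_l /clique_pair nth_index.
exists (fun i : 'I_k => Posz i) => [i j [] /val_inj //|i j].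
rewrite /complete_graph -val_eqE neq_ltn => /orP[] lt_ij; apply/answer_graphP.
  have [l [lt_l nth_l eq_l]] := won _ _ lt_ij (ltn_ord j).
  by exists l; rewrite size_nseq nth_l eq_l /same_pair eqxx.
have [l [lt_l nth_l eq_l]] := won _ _ lt_ij (ltn_ord i).
by exists l; rewrite size_nseq nth_l eq_l /same_pair eqxx orbT.
Qed.

Lemma exists_expr_le_half (R : realType) (q : R) :
  0 < q <= 1 -> exists k, (1 - q) ^+ k <= 1 / 2.
Proof.
move=> /andP[q0 q1].
(* The inductive step is [(1 - q)(1 + (k+1)q) = 1 + kq - (k+1)q^2]. *)
have bernoulli k : (1 - q) ^+ k * (1 + k%:R * q) <= 1.
  elim: k => [|k IH]; first by rewrite expr0 mul0r addr0 mul1r.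
  apply: le_trans IH; rewrite exprSr -mulrA ler_wpM2l ?exprn_ge0 ?subr_ge0 //.
  have k0 : 0 <= k%:R :> R by apply: ler0n.
  by rewrite -natr1; nra.
have invq0 : 0 <= q^-1 by rewrite invr_ge0 ltW.
(* A [k] above [1/q] makes the factor [1 + kq] at least 2. *)
exists (Num.bound q^-1); set k := Num.bound q^-1.
have kq : 1 <= k%:R * q.
  by rewrite -ler_pdivrMr // div1r ltW // archi_boundP.
have x0 : 0 <= (1 - q) ^+ k by rewrite exprn_ge0 // subr_ge0.
have := bernoulli k; move: ((1 - q) ^+ k) (k%:R * q) x0 kq => x y; nra.
Qed.

Lemma clique_query_winnable (R : realType) (k : nat) (p : R) :
  0 < p < 1 -> exists N, query_winnable (complete_graph k) p N.
Proof.
move=> hp; set N := size (clique_pairs k).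
set q := bits_prob p N (query_won (complete_graph k) (clique_strategy k)).
have q0 : 0 < q by apply: bits_prob_gt0 => //; apply: clique_strategy_won.
have q1 : q <= 1.
  rewrite -(@bits_prob_true R p N (fun=> True)) //; exact: bits_prob_sub.
have [|l le_half] := @exists_expr_le_half R q; first by rewrite q0.
have [u lu le_u] := query_repeat (complete_graph k) N l hp (@clique_strategy_legal k).
exists (l * N)%N, u => //.
by move: (le_trans le_u le_half); lra.
Qed.

Lemma is_minimum_exists (P : nat -> Prop) : (exists N, P N) -> exists N, is_minimum P N.
Proof.
move=> [N hN]; have exP : exists n, `[< P n >] by exists N; apply/asboolP.
exists (ex_minn exP); case: ex_minnP => n /asboolP Pn min_n.
by split=> // k /asboolP; apply: min_n.
Qed.

(** * Comparing the two games *)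

Lemma query_ramsey_winnable (R : realType) (m n : nat) (p : R) N : 0 < p < 1 ->
  query_winnable (complete_graph m) p N -> ramsey_winnable m n p N.
Proof.
move=> hp [s ls hs]; exists s => //; apply: le_trans hs _.
by apply: bits_prob_sub => // h _; left.
Qed.

Lemma query_ramsey_winnable_compl (R : realType) (m n : nat) (p : R) N : 0 < p < 1 ->
  query_winnable (complete_graph n) (1 - p) N -> ramsey_winnable m n p N.
Proof.
move=> hp [s ls hs]; exists (flip_strategy s); first exact: flip_strategy_legal.
move: hs; rewrite bits_prob_negb => hs; apply: le_trans hs _.
by apply: bits_prob_sub => // h _ won; right; apply: (@has_copy_flip _ _ s h true).
Qed.

(** Two runs would guarantee only [1 - (3/4)^2 = 7/16], short of one half; this is where the factor
    3 comes from. *)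
Lemma query_winnable_triple (R : realType) (T : finType) (H : rel T) (p : R) s N :
  0 < p < 1 -> legal s -> 1 / 4 <= bits_prob p N (query_won H s) ->
  query_winnable H p (3 * N).
Proof.
move=> hp ls hs; have [u lu le_u] := query_repeat H N 3 hp ls.
exists u => //.
have q1 : bits_prob p N (query_won H s) <= 1.
  rewrite -(@bits_prob_true R p N (fun=> True)) //; exact: bits_prob_sub.
have : (1 - bits_prob p N (query_won H s)) ^+ 3 <= (3 / 4) ^+ 3.
  by rewrite lerXn2r ?nnegrE; lra.
have -> : (3 / 4) ^+ 3 = 27 / 64 :> R by field.
lra.
Qed.

Lemma ramsey_query_winnable (R : realType) (m n : nat) (p : R) N : 0 < p < 1 ->
  ramsey_winnable m n p N ->
  query_winnable (complete_graph m) p (3 * N) \/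
  query_winnable (complete_graph n) (1 - p) (3 * N).
Proof.
move=> hp [s ls hs].
have := le_trans hs (bits_prob_or _ _ _ hp).
set red := bits_prob _ _ _; set blue := bits_prob _ _ _ => le_sum.
have [le_red|lt_red] := lerP (1 / 4) red.
  by left; apply: (@query_winnable_triple _ _ _ _ s).
right; apply: (@query_winnable_triple _ _ _ _ (flip_strategy s)).
- by lra.
- exact: flip_strategy_legal.
rewrite bits_prob_negb; apply: (@le_trans _ _ blue); first by lra.
apply: bits_prob_sub => // h _ won.
(* Negating the answers twice restores the history on which [s] built its blue clique. *)
by apply: (@has_copy_flip _ _ s _ false); rewrite (mapK negbK).
Qed.

Theorem theorem10 (R : realType) (m n : nat) (p : R) :
  (3 <= m)%N -> (3 <= n)%N -> 0 < p < 1 ->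
  exists r a b : nat,
    [/\ is_online_ramsey m n p r,
        is_subgraph_query (complete_graph m) p a,
        is_subgraph_query (complete_graph n) (1 - p) b
      & (r <= minn a b <= 3 * r)%N].
Proof.
move=> _ _ hp; have hp' : 0 < 1 - p < 1 by lra.
have [a mina] := is_minimum_exists (clique_query_winnable m hp).
have [b minb] := is_minimum_exists (clique_query_winnable n hp').
have ram_a : ramsey_winnable m n p a by apply: query_ramsey_winnable mina.1.
have ram_b : ramsey_winnable m n p b by apply: query_ramsey_winnable_compl minb.1.
have [r minr] := is_minimum_exists (ex_intro (ramsey_winnable m n p) a ram_a).
exists r, a, b; split=> //; rewrite leq_min !minr.2 //= geq_min.
(* Whichever clique is winnable in [3 * r] queries, minimality bounds its [a] or [b], hence the
   smaller of the two. *)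
by case: (ramsey_query_winnable hp minr.1) => [/mina.2|/minb.2] ->;
  rewrite ?orbT.
Qed.
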